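(* For the online multiple-processor multitask scheduling problem described in the context, the Modified SRPT (M-SRPT) algorithm has competitive ratio for total response time at most $$\mathcal{CR}_{\mathrm{M\text{-}SRPT}}\le 4\log\alpha+2\beta+8 .$$
   Context: Problem: there are $N$ identical machines of unit speed. A finite set of $n$ jobs arrives online; job $i$ has release date $r_i\ge 0$ and consists of $n_i$ tasks with processing times $p_i^{(\ell)}>0$, $\ell\in[n_i]$; its workload is $p_i=\sum_{\ell}p_i^{(\ell)}$. Each task is either preemptive or non-preemptive; a non-preemptive task, once started, must be processed without interruption until it completes. Each machine processes at most one task at a time (tasks of the same job may or may not be allowed to run in parallel; either convention may be used). No information about job $i$ is available before time $r_i$. The completion time $C_i$ of job $i$ is the maximum of the completion times of its tasks, its response time is $F_i=C_i-r_i$, and the cost of a schedule is $\sum_i F_i$. Let $\alpha=\max_i p_i/\min_i p_i$, $\eta$ = the maximum processing time of a non-preemptive task, and $\beta=\eta/\min_i p_i$. The competitive ratio of an online algorithm $\mathcal A$ is the supremum over all instances of the ratio of its cost to the cost of an optimal offline schedule. Logarithms are to base 2. M-SRPT: at every time $t$, each machine that is running a started non-preemptive task continues it; all other machines are assigned to alive (unfinished) jobs, giving priority to jobs with smaller remaining total workload $W_i(t)$ (SRPT order on jobs); the tasks within a job are processed in an arbitrary order. *)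

(* Defs.v *)
From HB Require Import structures.
From mathcomp Require Import all_boot all_order all_algebra.
From mathcomp Require Import all_classical all_reals all_analysis.
Set Implicit Arguments. Unset Strict Implicit. Unset Printing Implicit Defensive.
Import Order.TTheory GRing.Theory Num.Theory.
Local Open Scope ring_scope.
Local Open Scope classical_set_scope.

(* Online multiple-processor multitask scheduling.
   - machines: 'I_N (identical, unit speed);
   - jobs: a finite type J, job i released at r i;
   - tasks: a finite type T, task k belongs to job (job k), has processing
     time p k > 0 and is non-preemptive iff np k.
   Convention (the paper allows either): tasks of the same job may NOT run in
   parallel, i.e. at any time a job occupies at most one machine.
   A (continuous-time) schedule assigns to each time t and machine m the task
   it processes (or None = idle). *)

Section Scheduling.
Context {R : realType} {N : nat} {J T : finType}
  (job : T -> J) (r : J -> R) (p : T -> R) (np : T -> bool).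

Definition schedule := R -> 'I_N -> option T.

Definition work (i : J) : R := \sum_(k | job k == i) p k.
Definition work_max : R := \big[Num.max/0]_(i : J) work i.
(* minimum of the workloads (initial value work_max is harmless: J is
   nonempty whenever the instance has a job) *)
Definition work_min : R := \big[Num.min/work_max]_(i : J) work i.
Definition alpha : R := work_max / work_min.
Definition eta : R := \big[Num.max/0]_(k | np k) p k.
Definition beta : R := eta / work_min.
Definition log2 (x : R) : R := ln x / ln 2.

Section OneSchedule.
Variable s : schedule.

Definition processed_set (k : T) (t : R) : set (measurableTypeR R) :=
  [set u | (0 <= u < t) /\ exists m, s u m = Some k].
Definition amount (k : T) (t : R) : R := fine (lebesgue_measure (processed_set k t)).
Definition task_done (k : T) (t : R) : Prop := p k <= amount k t.
Definition task_completion (k : T) : R := inf [set t | task_done k t].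
Definition job_completion (i : J) : R :=
  \big[Num.max/0]_(k | job k == i) task_completion k.
Definition cost : R := \sum_(i : J) (job_completion i - r i).

Definition remaining (i : J) (t : R) : R := \sum_(k | job k == i) (p k - amount k t).
Definition alive (i : J) (t : R) : Prop := r i <= t /\ 0 < remaining i t.

Definition feasible : Prop :=
  [/\
      (forall t m k, s t m = Some k -> r (job k) <= t),
      (forall t m1 m2 k1 k2, s t m1 = Some k1 -> s t m2 = Some k2 ->
           job k1 = job k2 -> m1 = m2),
      (forall m k, measurable ([set t | s t m = Some k] : set (measurableTypeR R))),
      (forall k, exists t, task_done k t) &
      (forall k, np k -> exists (m0 : 'I_N) (S : R),
           forall t m, s t m = Some k <-> (m = m0 /\ S <= t < S + p k))].

Definition np_running (t : R) (m : 'I_N) : Prop :=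
  exists k, [/\ s t m = Some k, np k & 0 < amount k t].
Definition served (i : J) (t : R) : Prop :=
  exists m k, s t m = Some k /\ job k = i.

(* s is a schedule produced by M-SRPT: feasible; machines running a started
   non-preemptive task continue it (forced by feasibility); every other
   machine processes an unfinished task of an alive job, and these machines
   are given to alive jobs in SRPT order on the remaining workload W_i(t):
   if an alive job is not processed at t, then every other machine is busy
   with a job of remaining workload at most its own (ties arbitrary). Tasks
   within a job are chosen arbitrarily. *)
Definition msrpt : Prop :=
  feasible /\ forall t, 0 <= t ->
   (forall m k, ~ np_running t m -> s t m = Some k ->
       alive (job k) t /\ amount k t < p k) /\
   (forall j, alive j t -> ~ served j t ->
       forall m, ~ np_running t m ->
         exists k, s t m = Some k /\ remaining (job k) t <= remaining j t).

End OneSchedule.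
End Scheduling.

(* Main.v *)
Require Import Defs.
From HB Require Import structures.
From mathcomp Require Import all_boot all_order all_algebra.
From mathcomp Require Import all_classical all_reals all_analysis.
From mathcomp Require Import measurable_realfun ring lra.
Set Implicit Arguments. Unset Strict Implicit. Unset Printing Implicit Defensive.
Import Order.TTheory GRing.Theory Num.Theory.
Import numFieldNormedType.Exports.
Local Open Scope classical_set_scope.
Local Open Scope ring_scope.

(** Integrating over time reduces the theorem to a pointwise inequality: at each
    time [t], the number of jobs alive under M-SRPT is at most
    [c * #served(t) + 2 * #alive'(t)], where [alive'] refers to the competing
    schedule and [c = 2 K + 6 + beta] with [K <= log2 alpha]; the jobs served
    integrate to the total workload, which every schedule's cost dominates.

    If a machine idles at [t], every alive job is served. Otherwise fix a workload
    threshold [x] and let [v] be the last time before [t] at which some machine,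
    not bound by a started non-preemptive task, was idle or ran a job of
    remaining workload at least [x]. Apart from the at most [N] tasks then running
    non-preemptively (each for at most [eta] more), all machines work on jobs below
    [x] after [v], while at most [2 N] jobs released before [v] are or get below
    [x]. Hence the volume of jobs below [x] exceeds that of the competing schedule
    by at most [N (2 x + eta)]. Weighting these volume bounds at thresholds in
    geometric progression counts the alive jobs of remaining workload at least the
    minimal workload; at most [2 N] jobs lie below it.

    Schedules are merely measurable, so a job could a priori cross the level [x]
    without being served at the crossing time. The map from times to remaining
    workloads sends the unserved times to a null set, so almost every [x] is free
    of this problem. *)

(** * Lengths of sets of times, and images under nonincreasing Lipschitz functions *)

Section Measure.
Context {R : realType}.
Local Notation mu := (@lebesgue_measure R).
Implicit Types (A B P : set (measurableTypeR R)) (f : R -> R) (a b : R).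

Definition len A : R := fine (mu A).

Definition co a b : set (measurableTypeR R) := [set u | a <= u < b].

Lemma co_itv a b : co a b = `[a, b[%classic.
Proof. by apply/seteqP; split=> u /=; rewrite in_itv. Qed.

Lemma measurable_co a b : measurable (co a b).
Proof. by rewrite co_itv; exact: measurable_itv. Qed.

Lemma mu_co a b : a <= b -> mu (co a b) = (b - a)%:E.
Proof.
rewrite co_itv lebesgue_measure_itv/= lte_fin le_eqVlt => /predU1P[->|->].
  by rewrite ltxx subrr.
by rewrite EFinD EFinN.
Qed.

Lemma len_co a b : a <= b -> len (co a b) = b - a.
Proof. by move=> ab; rewrite /len mu_co. Qed.

Lemma mu_co_fin A a b : measurable A -> A `<=` co a b -> (mu A < +oo)%E.
Proof.
move=> mA Aab; have [ab|ba] := leP a b.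
  apply: (@le_lt_trans _ _ (mu (co a b))); last by rewrite mu_co// ltry.
  by apply: le_measure => //; rewrite inE//; exact: measurable_co.
suff -> : A = set0 by rewrite measure0.
apply/seteqP; split=> // u /Aab /= /andP[au ub].
by move: (lt_le_trans ub (ltW ba)); rewrite ltNge au.
Qed.

Lemma measurable_coI A a b : measurable A -> measurable (A `&` co a b).
Proof. by move=> mA; apply: measurableI => //; exact: measurable_co. Qed.

Lemma mu_coI_fin A a b : measurable A -> (mu (A `&` co a b) < +oo)%E.
Proof.
move=> mA; apply: (@mu_co_fin _ a b); last by move=> u [].
exact: measurable_coI.
Qed.

Lemma lenE A : (mu A < +oo)%E -> mu A = (len A)%:E.
Proof. by move=> Afin; rewrite /len fineK// ge0_fin_numE. Qed.

Lemma len_ge0 A : 0 <= len A.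
Proof. exact: fine_ge0. Qed.

Lemma le_len A B : measurable A -> measurable B -> (mu B < +oo)%E ->
  A `<=` B -> len A <= len B.
Proof.
move=> mA mB Bfin AB; have lAB : (mu A <= mu B)%E by apply: le_measure; rewrite ?inE.
by rewrite -lee_fin -!lenE// (le_lt_trans lAB).
Qed.

(** Integrating over time turns a pointwise inequality between counts into one between lengths. *)
Lemma sum_len_le (I K : finType) (A : I -> set (measurableTypeR R))
    (B : K -> set (measurableTypeR R)) (c : K -> R) :
  (forall i, measurable (A i)) -> (forall k, measurable (B k)) ->
  (forall i, mu (A i) < +oo)%E -> (forall k, mu (B k) < +oo)%E ->
  (forall k, 0 <= c k) ->
  (forall u, \sum_i \1_(A i) u <= \sum_k c k * \1_(B k) u) ->
  \sum_i len (A i) <= \sum_k c k * len (B k).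
Proof.
move=> mA mB Afin Bfin c0 AB.
have SA : (\int[mu]_x (\sum_i (\1_(A i) x)%:E) = (\sum_i len (A i))%:E)%E.
  rewrite ge0_integral_sum//=.
    rewrite -sumEFin; apply: eq_bigr => i _.
    by rewrite integral_indic// setIT; exact: lenE.
  by move=> i; apply/measurable_EFinP/measurable_indic.
have SB : (\int[mu]_x (\sum_k (c k * \1_(B k) x)%:E) = (\sum_k c k * len (B k))%:E)%E.
  rewrite ge0_integral_sum//=.
  - rewrite -sumEFin; apply: eq_bigr => k _; under eq_integral do rewrite EFinM.
    rewrite ge0_integralZl//.
    + by rewrite integral_indic// setIT EFinM; congr (_ * _)%E; exact: lenE.
    + by apply/measurable_EFinP/measurable_indic.
    + by rewrite lee_fin.
  - move=> k; apply/measurable_EFinP/measurable_funM => //.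
  - by move=> k x _; rewrite lee_fin mulr_ge0.
rewrite -lee_fin -SA -SB; apply: ge0_le_integral => //.
- by move=> x _; apply: sume_ge0.
- apply: emeasurable_sum => i; exact/measurable_EFinP/measurable_indic.
- apply: emeasurable_sum => k; apply/measurable_EFinP/measurable_funM => //.
- by move=> x _; rewrite !sumEFin lee_fin.
Qed.

Lemma lenD_co A a b c : measurable A -> a <= b -> b <= c ->
  len (A `&` co a c) = len (A `&` co a b) + len (A `&` co b c).
Proof.
move=> mA ab bc.
have -> : A `&` co a c = (A `&` co a b) `|` (A `&` co b c).
  apply/seteqP; split=> u.
    rewrite /co/= => -[Au /andP[au uc]].
    by case: (ltP u b) => ub; [left|right]; rewrite /co/= ?au ?ub ?uc.
  rewrite /co/= => -[[Au /andP[au ub]]|[Au /andP[bu uc]]]; split=> //.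
    by rewrite au (lt_le_trans ub bc).
  by rewrite uc (le_trans ab bu).
rewrite /len measureU//.
- by rewrite fineD// ge0_fin_numE//; exact: mu_coI_fin.
- exact: measurable_coI.
- exact: measurable_coI.
- apply/seteqP; split=> // u /= [[_ /andP[_ ub]] [_ /andP[bu _]]].
  by move: ub; rewrite ltNge bu.
Qed.

(** The hypothesis on [f], met by remaining workloads, makes it nonincreasing and 1-Lipschitz, hence
    continuous. *)
Lemma lipschitz_IVT f a b v : (forall x y, x <= y -> 0 <= f x - f y <= y - x) ->
  a <= b -> f b <= v <= f a -> exists2 c, a <= c <= b & f c = v.
Proof.
move=> lf ab fv.
have cf : continuous f.
  move=> x; apply/cvgrPdist_le => e e0; near=> y.
  have xy : `|x - y| < e by near: y; exact: (nbhsx_ballx x e e0).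
  apply: le_trans (ltW xy).
  case: (leP x y) => h.
    have /andP[h1 h2] := lf _ _ h.
    by rewrite ger0_norm// distrC ger0_norm// subr_ge0.
  have /andP[h1 h2] := lf _ _ (ltW h).
  by rewrite distrC ger0_norm// [leRHS]ger0_norm// subr_ge0 ltW.
have [||c] := @IVT R f a b v ab.
- by apply: continuous_subspaceT.
- case/andP: fv => h1 h2; rewrite ge_min le_max h1 h2 orbT//.
- by rewrite in_itv/= => abc <-; exists c.
Unshelve. all: by end_near. Qed.

(* [f] moves only on [P], so it maps the complement of [P] to a null set. *)
Lemma image_compl_null f P (lo hi e : R) : measurable P ->
  (forall a b, a <= b -> f a - f b = len (P `&` co a b)) -> 0 < e ->
  exists B : nat -> set (measurableTypeR R),
    [/\ forall n, measurable (B n),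
        f @` (co lo hi `\` P) `<=` \bigcup_n B n &
        (\sum_(n <oo) mu (B n) <= e%:E)%E].
Proof.
move=> mP fP e0; pose Q := co lo hi `\` P.
have mQ : measurable Q by apply: measurableD mP; exact: measurable_co.
have Qfin : (mu Q < +oo)%E by apply: (@mu_co_fin Q lo hi mQ) => u -[].
have e20 : 0 < e / 2 by rewrite divr_gt0.
have [U0 [oU0 QU0 U0e]] := lebesgue_regularity_outer mQ Qfin e20.
(* The added interval is open, contains [lo] thanks to the margin 1, and bounds the components of
   [U]. *)
pose U : set R := U0 `&` `](lo - 1), hi[%classic.
have oU : open U by exact: openI.
have QU : Q `<=` U.
  move=> u Qu; split; first exact: QU0.
  case: Qu => /andP[lu uh] _ /=; rewrite in_itv/= uh andbT; lra.
have mU : measurable (U : set (measurableTypeR R)) by exact: open_measurable.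
have mU0 : measurable (U0 : set (measurableTypeR R)) by exact: open_measurable.
pose I := open_disjoint_itv oU.
have UI : U = \bigcup_n I n by exact: open_disjoint_itv_bigcup.
have mI n : measurable (I n : set (measurableTypeR R)).
  by apply: open_measurable; exact: open_disjoint_itv_open.
have IU n : I n `<=` co (lo - 1) hi.
  move=> u Iu; have : U u by rewrite UI; exists n.
  by rewrite /co => -[_] /=; rewrite in_itv/= => /andP[/ltW -> ->].
pose L n := len (P `&` I n).
have PIfin n : (mu (P `&` I n) < +oo)%E.
  apply: (@mu_co_fin _ (lo - 1) hi); first exact: measurableI.
  by move=> u [_ /IU].
have fI n u v : I n u -> I n v -> u <= v -> 0 <= f u - f v <= L n.
  move=> Iu Iv uv; rewrite fP// len_ge0/=; apply: le_len => //.
  - exact: measurable_coI.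
  - exact: measurableI.
  - move=> w [Pw /andP[uw wv]]; split=> //.
    by apply: (open_disjoint_itv_is_interval Iu Iv); rewrite uw ltW.
(* On the component [I n] the function varies by at most [L n], so an interval of length [2 * L n]
   centred at any one of its values covers the image. *)
pose B n : set (measurableTypeR R) := if pselect (I n !=set0) is left h
  then `[f (sval (cid h)) - L n, f (sval (cid h)) + L n]%classic else set0.
exists B; split.
- by move=> n; rewrite /B; case: pselect => // h; exact: measurable_itv.
- move=> _ [w Qw <-]; have : U w by exact: QU.
  rewrite UI => -[n _ Iw]; exists n => //; rewrite /B.
  case: pselect => [h|]; last by case; exists w.
  case: cid => c Ic /=; rewrite in_itv/=.
  case: (leP c w) => cw.
    have := fI n c w Ic Iw cw; lra.
  have := fI n w c Iw Ic (ltW cw); lra.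
- have BL n : (mu (B n) <= 2%:E * mu (P `&` I n))%E.
    rewrite /B; case: pselect => h; last by rewrite measure0 mule_ge0.
    have L0 : 0 <= L n by exact: len_ge0.
    rewrite lebesgue_measure_itv/= lte_fin (lenE (PIfin n)) -/(L n).
    case: ifP => _; last by rewrite -EFinM lee_fin mulr_ge0.
    by rewrite -EFinB -EFinM lee_fin; lra.
  apply: (@le_trans _ _ (\sum_(n <oo) (2%:E * mu (P `&` I n)))%E).
    exact: lee_nneseries.
  rewrite nneseriesZl//.
  rewrite -measure_semi_bigcup; last 3 first.
  + by move=> n; exact: measurableI.
  + by apply: trivIset_setIl; exact: open_disjoint_itv_trivIset.
  + by apply: bigcup_measurable => n _; exact: measurableI.
  rewrite -setI_bigcupr -UI.
  apply: (@le_trans _ _ (2%:E * (e / 2)%:E)%E); last first.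
    by rewrite -EFinM lee_fin; lra.
  rewrite lee_pmul2l//.
  (* Points of [P] lie outside [Q], so [P] meets [U] only within [U0] minus [Q], of measure below
     [e / 2]. *)
  apply: le_trans (ltW U0e).
  apply: le_measure; rewrite ?inE.
  + exact: measurableI.
  + by apply: measurableD.
  + by move=> u [Pu [Uu _]]; split=> // -[].
Qed.

End Measure.

(** * Generic levels, attained only at times in the moving sets *)

Section GenericLevel.
Context {R : realType}.
Local Notation mu := (@lebesgue_measure R).
Implicit Types (A B P : set (measurableTypeR R)) (a b : R).

Lemma len0 : len (set0 : set (measurableTypeR R)) = 0.
Proof. by rewrite /len measure0. Qed.

Lemma sum_unit (c : R) : \sum_(i : unit) c = c.
Proof. by rewrite sumr_const card_unit. Qed.

Lemma len_le_sum (I : finType) (A : I -> set (measurableTypeR R)) B :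
  (forall i, measurable (A i)) -> measurable B ->
  (forall i, mu (A i) < +oo)%E -> (mu B < +oo)%E ->
  (forall u, (\1_B u : R) <= \sum_i \1_(A i) u) ->
  len B <= \sum_i len (A i).
Proof.
move=> mA mB Afin Bfin AB.
have : \sum_(i : unit) len B <= \sum_i 1 * len (A i).
  apply: (@sum_len_le R unit I (fun=> B) A (fun=> 1)) => // u; rewrite sum_unit.
  by under eq_bigr do rewrite mul1r; exact: AB.
by rewrite sum_unit; under [X in _ <= X -> _]eq_bigr do rewrite mul1r.
Qed.

Lemma sum_len_eq (I : finType) (A : I -> set (measurableTypeR R)) B :
  (forall i, measurable (A i)) -> measurable B ->
  (forall i, mu (A i) < +oo)%E -> (mu B < +oo)%E ->
  (forall u, \sum_i \1_(A i) u = (\1_B u : R)) ->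
  \sum_i len (A i) = len B.
Proof.
move=> mA mB Afin Bfin AB; apply/le_anti/andP; split; last first.
  by apply: len_le_sum => // u; rewrite AB.
have : \sum_i len (A i) <= \sum_(i : unit) 1 * len B.
  apply: (@sum_len_le R I unit A (fun=> B) (fun=> 1)) => // u.
  by rewrite sum_unit mul1r AB.
by rewrite sum_unit mul1r.
Qed.

(** As [P] contains no negative time, [co 0] may be extended to the left of 0, which also covers
    negative [a]. *)
Lemma len_coB P a b : measurable P -> P `<=` [set u | 0 <= u] -> a <= b ->
  len (P `&` co 0 b) - len (P `&` co 0 a) = len (P `&` co a b).
Proof.
move=> mP P0 ab.
have coE l c : l <= 0 -> P `&` co 0 c = P `&` co l c.
  move=> l0; rewrite /co; apply/seteqP; split=> u /= [Pu /andP[h ->]]; split=> //.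
    by rewrite (le_trans l0 h).
  by rewrite andbT; exact: P0.
have l0 : Num.min a 0 <= 0 by rewrite ge_min lexx orbT.
have la : Num.min a 0 <= a by rewrite ge_min lexx.
rewrite (coE _ b l0) (coE _ a l0) (lenD_co mP la ab); lra.
Qed.

(** Each [f i] maps the times outside [P i] to a null set, and finitely many null sets cannot cover
    an interval. *)
Lemma exists_generic (I : finType) (f : I -> R -> R)
    (P : I -> set (measurableTypeR R)) (lo hi a b : R) :
  (forall i, measurable (P i)) ->
  (forall i c d, c <= d -> f i c - f i d = len (P i `&` co c d)) -> a < b ->
  exists2 x, a < x < b & forall i w, lo <= w < hi -> f i w = x -> P i w.
Proof.
move=> mP fP ab; apply/not_exists2P => nx.
(* The sets [D i] below then have total length at most [(b - a) / 2]; the successor keeps the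
   divisor nonzero for empty [I]. *)
pose e := (b - a) / 2 / (#|I|.+1)%:R.
have e0 : 0 < e by rewrite !divr_gt0// subr_gt0.
have [B BP] := choice (fun i => @image_compl_null R (f i) (P i) lo hi e (mP i) (fP i) e0).
pose D i := \bigcup_n B i n.
have mB i n : measurable (B i n) by case: (BP i).
have mD i : measurable (D i) by exact: bigcup_measurable.
have De i : (mu (D i) <= e%:E)%E.
  case: (BP i) => _ _; apply: le_trans; apply: measure_sigma_subadditive => //.
have Dfin i : (mu (D i) < +oo)%E by rewrite (le_lt_trans (De i))// ltry.
pose A : set (measurableTypeR R) := `]a, b[%classic.
have mA : measurable A by exact: measurable_itv.
have muA : mu A = (b - a)%:E by rewrite lebesgue_measure_itv/= lte_fin ab EFinB.
have lenA : len A = b - a by rewrite /len muA.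
suff : len A <= \sum_i len (D i).
  apply/negP; rewrite -ltNge lenA.
  have : \sum_i len (D i) <= \sum_(i : I) e.
    by apply: ler_sum => i _; rewrite -lee_fin -lenE.
  move/le_lt_trans; apply.
  rewrite sumr_const -mulr_natr /e.
  apply: (@le_lt_trans _ _ ((b - a) / 2)); last lra.
  rewrite -mulrA; apply: ler_piMr; first by rewrite divr_ge0// subr_ge0 ltW.
  by rewrite ler_pdivrMl ?ltr0n// mulr1 ler_nat.
apply: len_le_sum => //; first by rewrite muA ltry.
move=> u; rewrite indicE; case: (boolP (u \in A)) => uA; last exact: sumr_ge0.
case: (nx u) => [[]|nu]; first by move: uA; rewrite inE /A/= in_itv.
have [i [w [whl fwu nPw]]] : exists i w, [/\ lo <= w < hi, f i w = u & ~ P i w].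
  apply: contrapT => h; apply: nu => i w whl fwu; apply: contrapT => nPw.
  by apply: h; exists i, w.
rewrite (bigD1 i)//= indicE.
have -> : u \in D i.
  by rewrite inE; case: (BP i) => _ + _; apply; exists w.
by rewrite lerDl; exact: sumr_ge0.
Qed.

End GenericLevel.

(** * Work received by tasks and jobs under a feasible schedule *)

Section Schedules.
Context {R : realType} {N : nat} {J T : finType}.
Variables (job : T -> J) (r : J -> R) (p : T -> R) (np : T -> bool).
Variable s : @schedule R N T.
Hypothesis r_ge0 : forall i, 0 <= r i.
Hypothesis p_gt0 : forall k, 0 < p k.
Hypothesis feas : feasible job r p np s.
Local Notation mu := (@lebesgue_measure R).
Local Notation amount := (amount s).
Local Notation served := (served job s).
Local Notation remaining := (remaining job p s).
Implicit Types (i j : J) (k : T) (m : 'I_N) (a b t u v x : R).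

Definition proc k : set (measurableTypeR R) := [set u | exists m, s u m = Some k].
Definition srv i : set (measurableTypeR R) := [set u | served i u].

Lemma release_le u m k : s u m = Some k -> r (job k) <= u.
Proof. by case: feas => + _ _ _ _; apply. Qed.

Lemma same_machine u m1 m2 k1 k2 :
  s u m1 = Some k1 -> s u m2 = Some k2 -> job k1 = job k2 -> m1 = m2.
Proof. by case: feas => _ + _ _ _; apply. Qed.

Lemma measurable_proc k : measurable (proc k).
Proof.
case: feas => _ _ ms _ _.
have -> : proc k = \bigcup_(m in [set: 'I_N]) [set u | s u m = Some k].
  by apply/seteqP; split=> u [m]; [exists m|move=> _; exists m].
exact: fin_bigcup_measurable.
Qed.

Lemma measurable_srv i : measurable (srv i).
Proof.
have -> : srv i = \bigcup_(k in [set k | job k = i]) proc k.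
  apply/seteqP; split=> [u [m [k [smk ki]]]|u [k ki [m smk]]].
    by exists k => //; exists m.
  by exists m, k.
by apply: fin_bigcup_measurable => // k _; exact: measurable_proc.
Qed.

Lemma proc_ge0 k : proc k `<=` [set u | 0 <= u].
Proof. by move=> u [m /release_le]; exact: le_trans. Qed.

Lemma srv_ge0 i : srv i `<=` [set u | 0 <= u].
Proof. by move=> u [m [k [/release_le + _]]]; exact: le_trans. Qed.

Lemma srv_release i u : srv i u -> r i <= u.
Proof. by move=> [m [k [/release_le + <-]]]. Qed.

Lemma amountE k t : amount k t = len (proc k `&` co 0 t).
Proof.
rewrite /amount /processed_set /len; congr (fine (mu _)).
by apply/seteqP; split=> u [].
Qed.

Lemma amountB k a b : a <= b -> amount k b - amount k a = len (proc k `&` co a b).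
Proof.
by move=> ab; rewrite !amountE len_coB//; [exact: measurable_proc|exact: proc_ge0].
Qed.

Lemma le_len_co A a b : a <= b -> measurable A -> len (A `&` co a b) <= b - a.
Proof.
move=> ab mA; rewrite -(len_co ab); apply: le_len => //.
- exact: measurable_coI.
- exact: measurable_co.
- by rewrite mu_co// ltry.
Qed.

Lemma amount_lip k a b : a <= b -> 0 <= amount k b - amount k a <= b - a.
Proof.
move=> ab; rewrite amountB// len_ge0 le_len_co//; exact: measurable_proc.
Qed.

Lemma le_amount k a b : a <= b -> amount k a <= amount k b.
Proof. by move=> /(amount_lip k)/andP[]; rewrite subr_ge0. Qed.

Lemma amount_before k t : t <= r (job k) -> amount k t = 0.
Proof.
move=> tr; rewrite amountE (_ : _ `&` _ = set0) ?len0//.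
apply/seteqP; split=> // u [[m /release_le ru] /andP[_ ut]].
by move: (le_lt_trans ru ut); rewrite ltNge tr.
Qed.

Lemma amount_ge0 k t : 0 <= amount k t.
Proof. by rewrite amountE len_ge0. Qed.

(** A job occupies at most one machine at a time, so the sets [proc k] of its tasks partition
    [srv i]. *)
Lemma sum_amount i t :
  \sum_(k | job k == i) amount k t = len (srv i `&` co 0 t).
Proof.
pose A k := if job k == i then proc k `&` co 0 t else set0.
have -> : \sum_(k | job k == i) amount k t = \sum_k len (A k).
  rewrite big_mkcond; apply: eq_bigr => k _; rewrite /A.
  by case: ifP => _; rewrite ?amountE ?len0.
have mA k : measurable (A k).
  by rewrite /A; case: ifP => // _; apply: measurable_coI; exact: measurable_proc.
apply: sum_len_eq => //.
- apply: measurable_coI; exact: measurable_srv.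
- move=> k; apply: (@mu_co_fin _ _ 0 t (mA k)).
  by rewrite /A; case: ifP => // _ u [].
- apply: mu_coI_fin; exact: measurable_srv.
move=> u; rewrite [RHS]indicE.
case: (boolP (u \in srv i `&` co 0 t)) => [|ni].
  rewrite inE => -[[m [k [smk ki]]] ut].
  rewrite (bigD1 k)//= indicE /A ki eqxx mem_set; last by split=> //; exists m.
  rewrite big1 ?addr0// => l lk; rewrite indicE; case: ifPn => [/eqP li|_]; last by rewrite in_set0.
  rewrite memNset// => -[[m' sml] _]; move: lk.
  have mm : m' = m by apply: (same_machine sml smk); rewrite li ki.
  by move: sml; rewrite mm smk => -[->]; rewrite eqxx.
apply: big1 => k _; rewrite indicE memNset// /A.
case: ifPn => [/eqP ki [[m smk] ut]|_ []]; move/negP: ni; apply.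
by rewrite inE; split=> //; exists m, k.
Qed.

Lemma remainingE i t : remaining i t = work job p i - len (srv i `&` co 0 t).
Proof. by rewrite /Defs.remaining big_split/= sumrN sum_amount. Qed.

Lemma remainingB i a b : a <= b ->
  remaining i a - remaining i b = len (srv i `&` co a b).
Proof.
move=> ab; rewrite !remainingE -(len_coB (measurable_srv i) (@srv_ge0 i) ab); lra.
Qed.

Lemma remaining_lip i a b : a <= b -> 0 <= remaining i a - remaining i b <= b - a.
Proof.
move=> ab; rewrite remainingB// len_ge0 le_len_co//; exact: measurable_srv.
Qed.

Lemma remaining_le i a b : a <= b -> remaining i b <= remaining i a.
Proof. by move=> /(remaining_lip i)/andP[]; rewrite subr_ge0. Qed.

Lemma remaining_release i t : t <= r i -> remaining i t = work job p i.
Proof.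
move=> tr; rewrite remainingE (_ : _ `&` _ = set0) ?len0 ?subr0//.
apply/seteqP; split=> // u [/srv_release ru /andP[_ ut]].
by move: (le_lt_trans ru ut); rewrite ltNge tr.
Qed.

(** Service at the end point [a] is harmless, a single instant having measure 0. *)
Lemma remaining_unserved i a b : a <= b ->
  (forall u, a < u < b -> ~ served i u) -> remaining i b = remaining i a.
Proof.
move=> ab ns; apply/eqP; rewrite eq_sym -subr_eq0 remainingB//.
have -> : len (srv i `&` co a b) = 0; last by [].
apply/le_anti/andP; split; last exact: len_ge0.
have <- : len ([set a] : set (measurableTypeR R)) = 0.
  by rewrite /len lebesgue_measure_set1.
apply: le_len.
- apply: measurable_coI; exact: measurable_srv.
- exact: measurable_set1.
- by rewrite lebesgue_measure_set1 ltry.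
- move=> u [su /andP[au ub]]; apply: contrapT => /eqP ua.
  by apply: (ns u _ su); rewrite ub andbT lt_neqAle au eq_sym ua.
Qed.

Lemma remaining_IVT i a b x : a <= b -> remaining i b <= x <= remaining i a ->
  exists2 c, a <= c <= b & remaining i c = x.
Proof. by apply: lipschitz_IVT => u v; exact: remaining_lip. Qed.

Definition nserved u : nat := #|[pred i | `[< served i u >]]|.

Lemma nserved_le u : (nserved u <= N)%N.
Proof.
rewrite -[leqRHS]card_ord; pose f m := omap job (s u m).
apply: leq_trans (leq_image_card f 'I_N).
have SI : injective (@Some J) by move=> i j [].
rewrite /nserved -(card_imset _ SI); apply: subset_leq_card.
apply/fintype.subsetP => _ /imsetP[i si ->].
have [m [k [smk ki]]] : served i u by apply/asboolP; exact: si.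
by apply/fintype.imageP; exists m => //; rewrite /f smk/= ki.
Qed.

(** Distinct machines serve distinct jobs, since the tasks of a job do not run in parallel. *)
Lemma nserved_busy u : (forall m, s u m) -> nserved u = N.
Proof.
move=> busy; apply/eqP; rewrite eqn_leq nserved_le/=.
have /choice[f fE] m : exists k, s u m = Some k.
  by case: (s u m) (busy m) => // k _; exists k.
rewrite -[leqLHS]card_ord -(@card_imset _ _ (job \o f)).
  apply: subset_leq_card; apply/fintype.subsetP => _ /imsetP[m _ ->].
  by apply/asboolP; exists m, (f m).
by move=> m1 m2; exact: same_machine.
Qed.

End Schedules.

(** * Processing capacity of the machines and volume left by a schedule *)

Section ScheduleVolume.
Context {R : realType} {N : nat} {J T : finType}.
Variables (job : T -> J) (r : J -> R) (p : T -> R) (np : T -> bool).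
Variable s : @schedule R N T.
Hypothesis r_ge0 : forall i, 0 <= r i.
Hypothesis p_gt0 : forall k, 0 < p k.
Hypothesis feas : feasible job r p np s.
Local Notation srv := (srv job s).
Local Notation nserved := (nserved job s).

Lemma sum_indic_srv u : \sum_i \1_(srv i) u = (nserved u)%:R :> R.
Proof.
rewrite /nserved -sum1_card natr_sum [RHS]big_mkcond/=.
apply: eq_bigr => i _; rewrite indicE. rewrite inE; case: ifPn => [/asboolP|/asboolP] h.
  by rewrite mem_set.
by rewrite memNset.
Qed.

Lemma indic_srv_co i (a b u : R) :
  \1_(srv i `&` co a b) u = \1_(srv i) u * \1_(co a b) u :> R.
Proof. by rewrite indicI. Qed.

Lemma sum_len_srv_le (a b : R) : a <= b ->
  \sum_i len (srv i `&` co a b) <= N%:R * (b - a).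
Proof.
move=> ab; rewrite -(len_co ab).
have : \sum_i len (srv i `&` co a b) <= \sum_(k : unit) N%:R * len (co a b).
  apply: (@sum_len_le R J unit (fun i => srv i `&` co a b) (fun=> co a b) (fun=> N%:R)).
  - move=> i; apply: measurable_coI; exact: (measurable_srv feas).
  - by move=> _; exact: measurable_co.
  - move=> i; apply: mu_coI_fin; exact: (measurable_srv feas).
  - by move=> _; rewrite mu_co// ltry.
  - by move=> _; exact: ler0n.
  - move=> u; rewrite sum_unit; under eq_bigr do rewrite indic_srv_co.
    rewrite -mulr_suml sum_indic_srv ler_wpM2r ?ler_nat//; exact: nserved_le.
by rewrite sum_unit.
Qed.

Lemma sum_len_srv_ge (a b : R) : a <= b -> (forall u m, a < u < b -> s u m) ->
  N%:R * (b - a) <= \sum_i len (srv i `&` co a b).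
Proof.
move=> ab busy.
(* Machines are known to be busy only strictly inside the interval; removing [a] does not change its
   length. *)
pose I : set (measurableTypeR R) := `]a, b[%classic.
have lI : len I = b - a.
  by rewrite -(len_co ab) /len co_itv !lebesgue_measure_itv.
have -> : N%:R * (b - a) = \sum_(m : 'I_N) len I.
  by rewrite lI sumr_const card_ord mulr_natl.
have -> : \sum_i len (srv i `&` co a b) = \sum_i 1 * len (srv i `&` co a b).
  by under [RHS]eq_bigr do rewrite mul1r.
apply: (@sum_len_le R 'I_N J (fun=> I) (fun i => srv i `&` co a b) (fun=> 1)) => //.
- by move=> _; exact: measurable_itv.
- move=> i; apply: measurable_coI; exact: (measurable_srv feas).
- move=> _; apply: (@mu_co_fin _ _ a b); first exact: measurable_itv.
  by move=> u; rewrite /I/= in_itv/co/= => /andP[/ltW -> ->].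
- move=> i; apply: mu_coI_fin; exact: (measurable_srv feas).
move=> u; under [leRHS]eq_bigr do rewrite mul1r indic_srv_co.
rewrite -mulr_suml sum_indic_srv sumr_const card_ord indicE.
case: (boolP (u \in I)) => uI; last by rewrite mul0rn mulr_ge0.
move: uI; rewrite inE /I/= in_itv/= => uab.
rewrite (nserved_busy feas) => [|m]; last exact: busy.
rewrite indicE mem_set ?mulr1//.
by rewrite /co/=; case/andP: uab => /ltW -> ->.
Qed.

(* Truncated at 0, since a feasible schedule may process a preemptive task beyond [p k]. *)
Definition trem i t : R := \sum_(k | job k == i) Num.max 0 (p k - amount s k t).

Lemma trem_ge0 i t : 0 <= trem i t.
Proof. by apply: sumr_ge0 => k _; rewrite le_max lexx. Qed.

Lemma trem_le_work i t : trem i t <= work job p i.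
Proof.
apply: ler_sum => k _; rewrite ge_max ltW//= lerBlDr lerDl.
exact: amount_ge0.
Qed.

(** Only an inequality: service time spent on a task beyond [p k] does not lower [trem]. *)
Lemma work_sub_trem i t : work job p i - trem i t <= len (srv i `&` co 0 t).
Proof.
rewrite -(sum_amount feas) lerBlDr -big_split/=; apply: ler_sum => k _.
by rewrite -lerBlDl le_max lexx orbT.
Qed.

(** Jobs released after [v] receive all their service within [[v, t[], where the machines deliver at
    most [N * (t - v)]. This will be applied to the competing schedule. *)
Lemma released_work_le (Q : pred J) (v t : R) : v <= t -> (forall i, Q i -> v <= r i) ->
  \sum_(i | Q i) work job p i <= N%:R * (t - v) + \sum_(i | Q i) trem i t.
Proof.
move=> vt Qv; rewrite -lerBlDr -sumrB.
apply: le_trans (sum_len_srv_le vt); rewrite big_mkcond.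
apply: ler_sum => i _; case: ifPn => [Qi|_]; last exact: len_ge0.
apply: le_trans (work_sub_trem i t) _; apply: le_len.
- apply: measurable_coI; exact: (measurable_srv feas).
- apply: measurable_coI; exact: (measurable_srv feas).
- apply: mu_coI_fin; exact: (measurable_srv feas).
- rewrite /co => u [su /= /andP[_ ut]]; split=> //=; rewrite ut andbT.
  exact: le_trans (Qv _ Qi) (srv_release feas su).
Qed.

End ScheduleVolume.

(** * The SRPT rule and the last unsaturated time *)

Section MSRPT.
Context {R : realType} {N : nat} {J T : finType}.
Variables (job : T -> J) (r : J -> R) (p : T -> R) (np : T -> bool).
Variable s : @schedule R N T.
Hypothesis N_gt0 : (0 < N)%N.
Hypothesis r_ge0 : forall i, 0 <= r i.
Hypothesis p_gt0 : forall k, 0 < p k.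
Hypothesis srpt : msrpt job r p np s.
Local Notation amount := (amount s).
Local Notation served := (served job s).
Local Notation rem := (remaining job p s).
Local Notation work := (work job p).
Local Notation eta := (Defs.eta p np).
Local Notation np_running := (np_running np s).

Let feas : feasible job r p np s. Proof. by case: srpt. Qed.

Lemma np_interval k : np k -> exists m0 S,
  forall t m, s t m = Some k <-> (m = m0 /\ S <= t < S + p k).
Proof. by case: feas => _ _ _ _; apply. Qed.

Lemma le_eta k : np k -> p k <= eta.
Proof. by move=> npk; exact: le_bigmax_cond. Qed.

Lemma eta_ge0 : 0 <= eta.
Proof. exact: bigmax_ge_id. Qed.

(** A non-preemptive task runs exactly on an interval of length [p k]. A preemptive one reaches
    [p k] by continuity before exceeding it, and from then on the M-SRPT rule forbids running it. *)
Lemma amount_le k t : amount k t <= p k.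
Proof.
have [npk|pk] := boolP (np k).
  have [m0 [S Sk]] := np_interval npk.
  have Sp : S <= S + p k by rewrite lerDl ltW.
  rewrite amountE.
  have -> : p k = len (co S (S + p k) : set (measurableTypeR R)).
    by rewrite len_co// addrAC subrr add0r.
  apply: le_len.
  - apply: measurable_coI; exact: (measurable_proc feas).
  - exact: measurable_co.
  - by rewrite mu_co// ltry.
  - by move=> u [[m /Sk[_ h]] _].
rewrite leNgt; apply/negP => pt.
have t0 : 0 <= t.
  rewrite leNgt; apply/negP => t0; move: pt.
  rewrite (amount_before feas (le_trans (ltW t0) (r_ge0 _))).
  by move=> /(lt_trans (p_gt0 k)); rewrite ltxx.
have [||c /andP[c0 ct] kc] := @lipschitz_IVT R (fun u => - amount k u) 0 t (- p k) _ t0.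
- by move=> x y xy /=; rewrite opprK addrC; exact: (amount_lip r_ge0 feas).
- by rewrite !lerN2 (ltW pt) (amount_before feas (r_ge0 _)) ltW.
move: kc => /oppr_inj kc.
have : amount k t - amount k c = 0.
  rewrite (amountB r_ge0 feas)// (_ : _ `&` _ = set0) ?len0//.
  apply/seteqP; split=> // u [[m smk]]; rewrite /co/= => /andP[cu _].
  have u0 : 0 <= u := le_trans c0 cu.
  have [/(_ m k) + _] := srpt.2 u u0.
  case=> //.
    by move=> [k' [smk' npk' _]]; move: smk'; rewrite smk => -[kk]; move: pk; rewrite kk npk'.
  move=> _; apply/negP; rewrite -leNgt -kc; exact: (le_amount r_ge0 feas).
by rewrite kc => /eqP; rewrite subr_eq0 => /eqP h; move: pt; rewrite h ltxx.
Qed.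

Lemma rem_ge0 i t : 0 <= rem i t.
Proof. by apply: sumr_ge0 => k _; rewrite subr_ge0 amount_le. Qed.

Definition saturated x u := forall m, np_running u m \/
  exists k, s u m = Some k /\ rem (job k) u < x.

Lemma saturated_busy x u m : saturated x u -> s u m.
Proof. by move=> /(_ m) [[k [-> _ _]]|[k [-> _]]]. Qed.

(** Some machine free to choose is idle or works at level at least [x]; leaving an alive job below
    [x] unserved would break the SRPT priority. *)
Lemma unsaturated_served x u j : 0 <= u -> ~ saturated x u ->
  alive job r p s j u -> rem j u < x -> served j u.
Proof.
move=> u0 nsat aj jx; apply: contrapT => nsj; apply: nsat => m.
apply: contrapT => /not_orP[nnp nk]; apply: nk.
have [_ /(_ _ aj nsj m nnp)[k [smk kj]]] := srpt.2 u u0.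
by exists k; split=> //; exact: le_lt_trans kj jx.
Qed.

(** Nothing is released at negative times, so every machine, and there is at least one, idles. This
    provides an unsaturated time to start from. *)
Lemma unsaturated_neg x u : u < 0 -> ~ saturated x u.
Proof.
move=> u0 /(@saturated_busy _ _ (Ordinal N_gt0)).
case E : (s u _) => [k|//] _; have := release_le feas E.
by move=> /(le_trans (r_ge0 _)); rewrite leNgt u0.
Qed.

(** At its start [S] nothing of the task has been processed, so the machine is not yet bound and its
    choice is subject to the SRPT rule. *)
Lemma np_start u m k : s u m = Some k -> np_running u m -> exists S,
  [/\ S <= u, u < S + eta, ~ np_running S m & forall v, S <= v <= u -> s v m = Some k].
Proof.
move=> smk [k' [smk' npk' a0]].
have [m0 [S Sk]] := np_interval npk'.
have [mm0 /andP[Su uS]] := (Sk u m).1 smk'.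
move: smk'; rewrite smk => -[kk]; exists S; split=> //.
- by apply: (lt_le_trans uS); rewrite lerD2l le_eta.
- have sS : s S m = Some k' by apply/Sk; rewrite lexx ltrDl p_gt0.
  move=> [k2 [smk2 _]]; move: smk2; rewrite sS => -[<-].
  rewrite amountE (_ : _ `&` _ = set0) ?len0 ?ltxx//.
  apply/seteqP; split=> // w [[m' /Sk[_ /andP[Sw _]]] /andP[_ wS]].
  by move: (le_lt_trans Sw wS); rewrite ltxx.
- move=> v /andP[Sv vu]; rewrite kk; apply/Sk; split=> //.
  by rewrite Sv (le_lt_trans vu uS).
Qed.

(* The last unsaturated time [v] is only a supremum; the unsaturated [u] approximates it. *)
Lemma last_unsaturated x t : 0 <= t -> exists v u,
  [/\ 0 <= v <= t, u <= v, ~ saturated x u, forall w, v < w <= t -> saturated x w &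
    forall i, (r i < v -> r i <= u) /\ (rem i v < x -> rem i u < x)].
Proof.
move=> t0; pose B := [set u | u <= t /\ ~ saturated x u].
have Bneg e : 0 < e -> B (- e).
  move=> e0; have e0' : - e < 0 by rewrite oppr_lt0.
  by split; [exact: ltW (lt_le_trans e0' t0)|exact: unsaturated_neg].
have B0 : B !=set0 by exists (- 1); exact: Bneg.
have Bt : ubound B t by move=> u [].
have hB : has_sup B by split=> //; exists t.
pose v := sup B.
have vB u : B u -> u <= v by apply: ub_le_sup; exists t.
have v0 : 0 <= v.
  by rewrite leNgt; apply/negP => v0; have := vB _ (Bneg (- v / 2) _); lra.
have vt : v <= t by exact: ge_sup.
(* If [u] is within [d i] of [v], a release before [v] is not after [u], and by the Lipschitz bound
   a workload below [x] at [v] is below [x] at [u]. *)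
pose d i := Num.min (if r i < v then v - r i else 1) (if rem i v < x then x - rem i v else 1).
pose e := \big[Num.min/1]_i d i.
have e0 : 0 < e.
  rewrite /e; elim/big_ind: _ => [//|a b a0 b0|i _]; first by rewrite lt_min a0.
  by rewrite /d lt_min; apply/andP; split; case: ifP => // h; rewrite subr_gt0.
have [u [ut nsat] vu] := sup_adherent e0 hB.
exists v, u; split=> //.
- by rewrite v0.
- by apply: vB.
- move=> w /andP[vw wt]; apply: contrapT => nw.
  by have : w <= v by [apply: vB]; rewrite leNgt vw.
move=> i; have ed : e <= d i by exact: bigmin_le_cond.
have uv : u <= v by apply: vB.
have := remaining_lip r_ge0 feas i uv.
move: ed vu; rewrite -/v /d le_min => /andP[].
case: ifP => h1; case: ifP => h2; move=> e1 e2 vu /andP[l1 l2]; split=> //= _; lra.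
Qed.

(** * Evolution of jobs around a generic level after the last unsaturated time *)

Section Generic.
Variables (x t v u : R).
Hypothesis generic : forall i w, 0 <= w < t + 1 -> rem i w = x -> served i w.
Hypothesis x_gt0 : 0 < x.
Hypothesis vt : 0 <= v <= t.
Hypothesis uv : u <= v.
Hypothesis unsat_u : ~ saturated x u.
Hypothesis sat : forall w, v < w <= t -> saturated x w.
Hypothesis u_close : forall i, (r i < v -> r i <= u) /\ (rem i v < x -> rem i u < x).

(** At a saturated time, a job at level at least [x] is served only by a bound machine. Its task
    cannot have started after [v]: at that start the machine was free, so saturation would put the
    job below [x]. Hence it was already running at [v]. *)
Lemma large_served i w : v < w <= t -> served i w -> x <= rem i w ->
  served i v /\ w < v + eta.
Proof.
move=> vwt [m [k [smk ki]]] xw; case/andP: (vwt) => vw wt.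
have npm : np_running w m.
  case: (sat vwt m) => // -[k' []]; rewrite smk => -[<-].
  by rewrite ki ltNge xw.
have [S [Sw wS nS Sk]] := np_start smk npm.
have Sv : S <= v.
  rewrite leNgt; apply/negP => vS.
  have vSt : v < S <= t by rewrite vS (le_trans Sw wt).
  case: (sat vSt m) => // -[k' []]; rewrite Sk ?lexx// => -[<-].
  rewrite ki ltNge (le_trans xw)//; exact: (remaining_le r_ge0 feas).
split; last by apply: (lt_le_trans wS); rewrite lerD2r.
by exists m, k; split=> //; apply: Sk; rewrite Sv ltW.
Qed.

(** Service at level at least [x] would imply service at [v]. Service below [x] requires crossing
    [x] first, and by genericity the job is served at the crossing. *)
Lemma unserved_const i : x < rem i v -> ~ served i v -> rem i t = rem i v.
Proof.
case/andP: (vt) => v0 vt' xv ns; apply: (remaining_unserved r_ge0 feas) => //.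
move=> w /andP[vw wt] sw.
have vwt : v < w <= t by rewrite vw ltW.
have wx : rem i w < x.
  by rewrite ltNge; apply/negP => /(large_served vwt sw)[].
have [|c /andP[vc cw] cx] := remaining_IVT r_ge0 feas (i := i) (x := x) (ltW vw).
  by rewrite !ltW.
have sc : served i c by apply: generic => //; lra.
have vct : v < c <= t.
  rewrite (le_trans cw (ltW wt)) andbT lt_neqAle vc andbT.
  by apply/eqP => vc'; move: xv; rewrite vc' cx ltxx.
by have [] := large_served vct sc; rewrite ?cx.
Qed.

(** The second and third cases involve, up to finished jobs, only jobs served at [u] or at [v],
    hence at most [N] for each of these two times. *)
Lemma job_cases i : r i <= t ->
  [\/ rem i v <= x /\ v <= r i,
      rem i v <= x /\ [\/ served i u, served i v | rem i v = 0],
      x < rem i v /\ served i v |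
      x < rem i v /\ rem i t = rem i v].
Proof.
case/andP: (vt) => v0 vt' rt.
have [xv|vx] := ltP x (rem i v).
  have [sv|nsv] := pselect (served i v); first by constructor 3.
  by constructor 4; split=> //; exact: unserved_const.
have [vr|rv] := leP v (r i); first by constructor 1.
(* The boundary value [rem i v = x] escapes the strict inequalities of [u_close]; genericity settles
   it. *)
constructor 2; split=> //.
have [vx'|xv] := ltP (rem i v) x; last first.
  constructor 2; apply: generic; first lra.
  by apply/le_anti; rewrite vx.
have [ru ux] := u_close i.
have [u0|u0] := eqVneq (rem i u) 0.
  constructor 3; apply/le_anti; rewrite rem_ge0 -u0 andbT.
  exact: (remaining_le r_ge0 feas).
constructor 1; apply: unsaturated_served unsat_u _ (ux vx').
  exact: le_trans (r_ge0 i) (ru rv).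
by split; [exact: ru|rewrite lt_neqAle eq_sym u0 rem_ge0].
Qed.

(** If the job reaches level [x], it does so before [v + eta], so it had at most [x + eta] left at
    [v]. Otherwise it is served only before [v + eta] and loses at most [eta]. *)
Lemma large_work_le i : x < rem i v -> served i v ->
  (if rem i t <= x then rem i t else 0) + (rem i v - rem i t) <= x + eta.
Proof.
case/andP: (vt) => v0 vt' xv sv; case: ifPn => [tx|]; last rewrite -ltNge => xt.
  have [|c /andP[vc ct] cx] := remaining_IVT r_ge0 feas (i := i) (x := x) vt'.
    by rewrite tx ltW.
  have sc : served i c by apply: generic => //; lra.
  have vct : v < c <= t.
    rewrite ct andbT lt_neqAle vc andbT.
    by apply/eqP => vc'; move: xv; rewrite vc' cx ltxx.
  have xc : x <= rem i c by rewrite cx.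
  have [_ ce] := large_served vct sc xc.
  by have := remaining_lip r_ge0 feas i vc; rewrite cx; lra.
pose z := Num.min (v + eta) t.
have zt : z <= t by rewrite ge_min lexx orbT.
have vz : v <= z by rewrite le_min vt' lerDl eta_ge0.
have ze : z <= v + eta by rewrite ge_min lexx.
have -> : rem i t = rem i z.
  apply: (remaining_unserved r_ge0 feas) => // w /andP[zw wt] sw.
  have vwt : v < w <= t by rewrite (le_lt_trans vz zw) ltW.
  have [|_ we] := large_served vwt sw.
    by apply: ltW; apply: (lt_le_trans xt); apply: (remaining_le r_ge0 feas); exact: ltW.
  by move: zw; rewrite ltNge le_min !ltW.
have := remaining_lip r_ge0 feas i vz.
move: x_gt0; lra.
Qed.

(** All machines are busy after [v], so [N * (t - v)] is at most the work done. Each job's final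
    volume plus work done is charged [x] if served at [u], [x + eta] if served at [v], and its
    workload if released later and small. *)
Lemma volume_jobs :
  \sum_(i | (r i <= t) && (rem i t <= x)) rem i t + N%:R * (t - v) <=
  N%:R * (2 * x + eta) + \sum_(i | [&& v <= r i, r i <= t & work i <= x]) work i.
Proof.
case/andP: (vt) => v0 vt'; have x0 := x_gt0.
have eta0 := eta_ge0.
have busy : N%:R * (t - v) <= \sum_i (rem i v - rem i t).
  under eq_bigr do rewrite (remainingB r_ge0 feas)//.
  apply: (sum_len_srv_ge feas) => // w m /andP[vw wt].
  by apply: (@saturated_busy x); apply: sat; rewrite vw ltW.
pose S w : pred J := [pred i | `[< served i w >]].
pose Q : pred J := fun i => [&& v <= r i, r i <= t & work i <= x].
have sumS w (c : R) : 0 <= c -> \sum_i (if S w i then c else 0) <= N%:R * c.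
  move=> c0; rewrite -big_mkcond sumr_const -[leLHS]mulr_natl.
  apply: ler_wpM2r => //; rewrite ler_nat; exact: (nserved_le job s w).
have job_le i :
  (if (r i <= t) && (rem i t <= x) then rem i t else 0) + (rem i v - rem i t) <=
  (if S u i then x else 0) + (if S v i then x + eta else 0) +
  (if Q i then work i else 0).
  have Su : 0 <= if S u i then x else 0 by case: ifP => // _; exact: ltW.
  have Sv : 0 <= if S v i then x + eta else 0 by case: ifP => // _; lra.
  have Q0 : 0 <= if Q i then work i else 0.
    by case: ifP => // _; apply: sumr_ge0 => k _; exact: ltW.
  have W0 := rem_ge0 i t.
  have := remaining_lip r_ge0 feas i vt' => /andP[Wvt _].
  have [rt|tr] := leP (r i) t; rewrite ?andTb ?andFb; last first.
    rewrite (remaining_release feas (ltW tr)).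
    rewrite (remaining_release feas (ltW (le_lt_trans vt' tr))); lra.
  case: (job_cases rt) => [[vx vr]|[vx]|[xv sv]|[xv ->]].
  - have -> : Q i by rewrite /Q vr rt -(remaining_release feas vr).
    rewrite -(remaining_release feas vr).
    case: (_ <= x); lra.
  - have -> : rem i t <= x by lra.
    move=> h; suff : rem i v <= (if S u i then x else 0) + (if S v i then x + eta else 0) by lra.
    case: h => [su|sv|->].
    + have -> : S u i by exact/asboolP.
      lra.
    + have -> : S v i by exact/asboolP.
      lra.
    + lra.
  - have -> : S v i by exact/asboolP.
    by have := large_work_le xv sv; lra.
  - have -> : (rem i v <= x) = false by rewrite leNgt xv.
    lra.
have := ler_sum (index_enum J) (P := xpredT) (fun i _ => job_le i).
rewrite !big_split/= -!big_mkcond/=.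
have := sumS u x (ltW x0); have := sumS v (x + eta) (addr_ge0 (ltW x0) eta0).
rewrite -!big_mkcond/=; move: busy; rewrite !big_split/= /Q; lra.
Qed.

(** With [x] below every workload, no job released after [v] is at most [x] at [v]; by [job_cases]
    the jobs counted here were served at [u] or at [v]. *)
Lemma tiny_jobs : (forall i, x < work i) ->
  (#|[pred i | `[< (r i <= t)%R /\ (0 < rem i t <= x)%R >]]| <= N + N)%N.
Proof.
case/andP: (vt) => v0 vt' xw.
apply: (@leq_trans (nserved job s u + nserved job s v)); last first.
  by apply: leq_add; exact: nserved_le.
rewrite -cardUI; apply: leq_trans (leq_addr _ _).
apply: subset_leq_card; apply/fintype.subsetP => i /asboolP[rt /andP[t0 tx]].
rewrite inE; apply/orP.
have tv := remaining_le r_ge0 feas i vt'.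
case: (job_cases rt) => [[vx vr]|[vx h]|[xv sv]|[xv h]].
- by move: vx; rewrite (remaining_release feas vr) leNgt xw.
- case: h => [h|h|h]; [by left; apply/asboolP|by right; apply/asboolP|].
  by move: tv; rewrite h leNgt t0.
- by right; apply/asboolP.
- by move: xv; rewrite -h ltNge tx.
Qed.

End Generic.
End MSRPT.

(** * Weights along a geometric progression of thresholds *)

Section Thresholds.
Context {R : realType}.
Variable y0 : R.
Hypothesis y0_gt0 : 0 < y0.
Implicit Types (w e : R) (K k : nat).

(** Starting at [2 * y0] lets the index obtained by rounding the logarithm down already reach the
    maximal workload. *)
Definition threshold k : R := 2 * y0 * 2 ^+ k.

Lemma threshold_gt0 k : 0 < threshold k.
Proof. by rewrite !mulr_gt0// exprn_gt0. Qed.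

Lemma thresholdS k : threshold k.+1 = 2 * threshold k.
Proof. by rewrite /threshold exprS; ring. Qed.

Lemma le_threshold k K : (k <= K)%N -> threshold k <= threshold K.
Proof.
by move=> kK; rewrite ler_pM2l ?mulr_gt0// ler_weXn2l// ler1n.
Qed.

(* The weight of the last threshold is doubled to make up for the missing tail of the geometric series. *)
Definition weighted K (V : R -> R) : R :=
  \sum_(k < K) (threshold k)^-1 * V (threshold k) +
  2 * (threshold K)^-1 * V (threshold K).

(** The weight of [threshold K] drops from twice its inverse to its inverse, and the new last weight
    equals that inverse too. *)
Lemma weightedS K V : weighted K.+1 V = weighted K V +
  (threshold K)^-1 * (V (threshold K.+1) - V (threshold K)).
Proof.
rewrite /weighted big_ord_recr/= thresholdS.
have yK := threshold_gt0 K; have yK0 := lt0r_neq0 yK.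
by field.
Qed.

Lemma le_weighted K V V' : (forall k, V (threshold k) <= V' (threshold k)) ->
  weighted K V <= weighted K V'.
Proof.
move=> VV; apply: lerD.
  by apply: ler_sum => k _; rewrite ler_wpM2l// invr_ge0 ltW ?threshold_gt0.
by rewrite ler_wpM2l// mulr_ge0// invr_ge0 ltW ?threshold_gt0.
Qed.

Lemma weightedD K V V' :
  weighted K (fun x => V x + V' x) = weighted K V + weighted K V'.
Proof.
rewrite /weighted; under eq_bigr do rewrite mulrDr.
by rewrite big_split/= mulrDr addrACA.
Qed.

Lemma weighted_sum K (I : finType) (P : pred I) (V : I -> R -> R) :
  weighted K (fun x => \sum_(i | P i) V i x) = \sum_(i | P i) weighted K (V i).
Proof.
rewrite /weighted big_split/= -mulr_sumr; congr (_ + _).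
rewrite exchange_big/=; by under eq_bigr do rewrite mulr_sumr.
Qed.

(** The linear part gains [a] per threshold, the source of the logarithm; the weights sum to [y0^-1]
    for every [K], the source of [beta]. *)
Lemma weighted_affine K (a b : R) :
  weighted K (fun x => a * x + b) = a * (K%:R + 2) + b / y0.
Proof.
elim: K => [|K IH].
  rewrite /weighted big_ord0 /threshold expr0; field; exact: lt0r_neq0.
rewrite weightedS IH thresholdS -natr1; have yK0 := lt0r_neq0 (threshold_gt0 K).
have y00 := lt0r_neq0 y0_gt0; by field; rewrite yK0 y00.
Qed.

(** The weights from the first threshold above [w] onwards sum to twice its inverse; [w] is at most
    that threshold, and at least half of it once [y0 <= w]. *)
Lemma weighted_trunc K w : 0 <= w <= threshold K ->
  (y0 <= w -> 1 <= weighted K (fun x => if w <= x then w else 0)) /\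
  weighted K (fun x => if w <= x then w else 0) <= 2.
Proof.
elim: K => [|K IH] /andP[w0 wK].
  rewrite /weighted big_ord0 add0r wK.
  have y2 : 0 < threshold 0 by exact: threshold_gt0.
  split=> [yw|].
    by rewrite -mulrA mulrCA ler_pdivlMl// mulr1 /threshold expr0; lra.
  by rewrite -mulrA ler_piMr// ler_pdivrMl// mulr1.
have yK := threshold_gt0 K.
have [wK'|Kw] := leP w (threshold K).
  by rewrite weightedS wK wK' subrr mulr0 addr0; apply: IH; rewrite w0.
rewrite /weighted big1 ?add0r => [|k _]; last first.
  case: ifPn => [wk|]; last by rewrite mulr0.
  have := lt_le_trans Kw wk; rewrite ltNge le_threshold//.
  by rewrite -ltnS ltn_ord.
rewrite wK; have y2 : 0 < threshold K.+1 by exact: threshold_gt0.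
split=> [_|].
  by rewrite -mulrA mulrCA ler_pdivlMl// mulr1 thresholdS; lra.
by rewrite -mulrA ler_piMr// ler_pdivrMl// mulr1.
Qed.

End Thresholds.

(** * Comparison of M-SRPT with a competing schedule at one time *)

Section Compare.
Context {R : realType} {N : nat} {J T : finType}.
Variables (job : T -> J) (r : J -> R) (p : T -> R) (np : T -> bool).
Variables s s' : @schedule R N T.
Hypothesis N_gt0 : (0 < N)%N.
Hypothesis r_ge0 : forall i, 0 <= r i.
Hypothesis p_gt0 : forall k, 0 < p k.
Hypothesis srpt : msrpt job r p np s.
Hypothesis feas' : feasible job r p np s'.
Local Notation rem := (remaining job p s).
Local Notation trem := (trem job p s').
Local Notation work := (work job p).
Local Notation eta := (Defs.eta p np).
Local Notation served := (served job s).

Let feas : feasible job r p np s. Proof. by case: srpt. Qed.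

Lemma generic_threshold (t a b : R) : a < b ->
  exists2 x, a < x < b & forall i w, 0 <= w < t + 1 -> rem i w = x -> served i w.
Proof.
move=> ab; apply: (@exists_generic _ _ rem (srv job s) 0 (t + 1) a b) => //.
- move=> i; exact: (measurable_srv feas).
- by move=> i c d; exact: (remainingB r_ge0 feas).
Qed.

(** Finitely many values leave a gap above [x], so [x] can be raised to a generic level without
    passing a value of the competing schedule. *)
Lemma exists_gap (I : finType) (F : I -> R) (x : R) :
  exists2 d, 0 < d & forall i, x < F i -> x + d <= F i.
Proof.
pose G i := if x < F i then F i - x else 1.
exists (\big[Num.min/1]_i G i) => [|i xF].
  elim/big_ind: _ => [//|a b a0 b0|i _]; first by rewrite lt_min a0.
  by rewrite /G; case: ifP => // h; rewrite subr_gt0.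
have : \big[Num.min/1]_i G i <= G i by exact: bigmin_le_cond.
rewrite {2}/G xF; lra.
Qed.

(** Apply [volume_jobs] at a generic [x1] slightly above [x], and bound the late releases by
    [released_work_le]: the two terms [N * (t - v)] cancel. A violation by [e > 0] is refuted by
    taking [2 * N * (x1 - x) < e]. *)
Lemma volume (x t : R) : 0 <= t -> 0 < x ->
  \sum_(i | r i <= t) (if rem i t <= x then rem i t else 0) <=
  \sum_(i | r i <= t) (if trem i t <= x then trem i t else 0) + N%:R * (2 * x + eta).
Proof.
move=> t0 x0; rewrite leNgt; apply/negP; set V := (X in _ < X); set V' := (X in X + _).
rewrite -subr_gt0; set e := (X in 0 < X) => e0.
have [d d0 dP] := exists_gap (trem ^~ t) x.
have N2 : 0 < 2 * N%:R :> R by rewrite mulr_gt0// ltr0n.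
have xx : x < x + Num.min d (e / (2 * N%:R)).
  by rewrite ltrDl lt_min d0 divr_gt0.
have [x1 /andP[xx1] + gen] := generic_threshold t xx.
rewrite -ltrBlDl lt_min => /andP[x1d]; rewrite ltr_pdivlMr// => x1e.
have x10 : 0 < x1 := lt_trans x0 xx1.
have [v [u [vt uv nsat sat uc]]] := last_unsaturated N_gt0 r_ge0 srpt x1 t0.
have := volume_jobs r_ge0 p_gt0 srpt gen x10 vt uv nsat sat uc.
case/andP: (vt) => v0 vt'.
pose Q i := [&& v <= r i, r i <= t & work i <= x1].
have Qv i : Q i -> v <= r i by case/and3P.
have := released_work_le feas' vt' Qv.
have : \sum_(i | Q i) trem i t <= V'.
  rewrite /V' [leLHS]big_mkcond [leRHS]big_mkcond; apply: ler_sum => i _; rewrite /Q.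
  have T0 : 0 <= trem i t by exact: trem_ge0.
  case: (leP (r i) t) => rt; rewrite ?andbF//=.
  case: ifPn => [/andP[_ wx]|_]; last by case: ifP.
  (* Otherwise [trem i t] would be at least [x + d], above [x1], yet it is at most [work i]. *)
  have [//|xT] := leP (trem i t) x; have := dP i xT; have := trem_le_work job s' p_gt0 i t; lra.
have : V <= \sum_(i | (r i <= t) && (rem i t <= x1)) rem i t.
  rewrite /V [leLHS]big_mkcond [leRHS]big_mkcond; apply: ler_sum => i _.
  have W0 := rem_ge0 r_ge0 p_gt0 srpt i t.
  case: (leP (r i) t) => rt //=; case: (leP (rem i t) x) => ix.
    by rewrite (le_trans ix (ltW xx1)).
  by case: ifP.
rewrite /Q; move: x1e; rewrite /e; lra.
Qed.

Lemma tiny (y t : R) : 0 <= t -> 0 < y -> (forall i, y <= work i) ->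
  (#|[pred i | (r i <= t)%R && (0 < rem i t < y)%R]| <= N + N)%N.
Proof.
move=> t0 y0 yw.
(* Any level strictly between [M] and [y] bounds the same jobs as [y] does, so a generic one can be
   taken. *)
pose M := \big[Num.max/0]_(i | rem i t < y) rem i t.
have My : M < y by apply: bigmax_lt.
have M0 : 0 <= M by exact: bigmax_ge_id.
have [x /andP[Mx xy] gen] := generic_threshold t My.
have x0 := le_lt_trans M0 Mx.
have [v [u [vt uv nsat sat uc]]] := last_unsaturated N_gt0 r_ge0 srpt x t0.
have xw i : x < work i := lt_le_trans xy (yw i).
apply: leq_trans (tiny_jobs r_ge0 p_gt0 srpt gen vt uv nsat sat uc xw).
apply: subset_leq_card; apply/fintype.subsetP => i /and3P[rt W0 Wy].
apply/asboolP; split=> //; rewrite W0/=; apply: le_trans (ltW Mx).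
exact: le_bigmax_cond.
Qed.

Definition alive_count t := #|[pred i | (r i <= t)%R && (0 < rem i t)%R]|.
Definition alive_count' t := #|[pred i | (r i <= t)%R && (0 < trem i t)%R]|.

(** In the weighted [volume] bound, each job counted on the left weighs at least 1 and each alive
    job of the competing schedule at most 2; the affine error gives the term in [N]. *)
Lemma large_count (y t : R) (K : nat) : 0 <= t -> 0 < y ->
  (forall i, work i <= threshold y K) ->
  (#|[pred i | (r i <= t)%R && (y <= rem i t)%R]|)%:R <=
  2 * (alive_count' t)%:R + N%:R * (2 * K%:R + 4 + eta / y).
Proof.
move=> t0 y0 wK.
pose V := fun x => \sum_(i | r i <= t) (if rem i t <= x then rem i t else 0).
pose V' := fun x => \sum_(i | r i <= t) (if trem i t <= x then trem i t else 0).
have VV' : weighted y K V <=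
    weighted y K V' + weighted y K (fun x => (2 * N%:R) * x + N%:R * eta).
  rewrite -weightedD; apply: le_weighted => // k.
  have := volume t0 (threshold_gt0 y0 k); rewrite -/(V _) -/(V' _); lra.
have lV : (#|[pred i | (r i <= t)%R && (y <= rem i t)%R]|)%:R <= weighted y K V.
  rewrite weighted_sum -sum1_card natr_sum [leLHS]big_mkcond [leRHS]big_mkcond.
  apply: ler_sum => i _; rewrite inE.
  have W0 := rem_ge0 r_ge0 p_gt0 srpt i t.
  have WK : rem i t <= threshold y K.
    apply: le_trans (wK i); rewrite (remainingE feas) lerBlDr lerDl; exact: len_ge0.
  have W0K : 0 <= rem i t <= threshold y K by rewrite W0.
  case: (leP (r i) t) => //= rt; case: ifPn => yW.
    by have [+ _] := weighted_trunc y0 W0K; apply.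
  by apply: addr_ge0; [apply: sumr_ge0 => k _|]; rewrite !mulr_ge0 ?invr_ge0 ?(ltW (threshold_gt0 y0 _))//; case: ifP.
have lV' : weighted y K V' <= 2 * (alive_count' t)%:R.
  rewrite weighted_sum /alive_count' -sum1_card natr_sum mulr_sumr.
  rewrite [leLHS]big_mkcond [leRHS]big_mkcond.
  apply: ler_sum => i _; rewrite inE.
  case: (leP (r i) t) => //= rt; rewrite mulr1.
  case: ifPn => [_|].
    have W0K : 0 <= trem i t <= threshold y K.
      by rewrite trem_ge0 (le_trans (trem_le_work job s' p_gt0 i t)).
    by have [] := weighted_trunc y0 W0K.
  rewrite -leNgt => h; have -> : trem i t = 0.
    by apply/le_anti; rewrite h trem_ge0.
  by rewrite /weighted big1 ?add0r => [|k _]; case: ifP => _; rewrite mulr0.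
move: VV'; rewrite weighted_affine//.
have -> : N%:R * (2 * K%:R + 4 + eta / y) = 2 * N%:R * (K%:R + 2) + N%:R * eta / y by ring.
lra.
Qed.

Lemma alive_count_le (y t : R) (K : nat) : 0 <= t -> 0 < y ->
  (forall i, y <= work i <= threshold y K) ->
  (alive_count t)%:R <=
  (2 * K%:R + 6 + eta / y) * (nserved job s t)%:R + 2 * (alive_count' t)%:R.
Proof.
move=> t0 y0 wK; have ey : 0 <= eta / y by rewrite divr_ge0 ?eta_ge0 ?ltW.
have K0 : 0 <= K%:R :> R by exact: ler0n.
have [busy|/existsNP[m nm]] := pselect (forall m, s t m).
  (* The constant 6 is the 4 of [large_count] plus 2 for the at most [2 * N] jobs below [y]. *)
  rewrite (nserved_busy feas busy).
  have : (alive_count t <= (N + N) + #|[pred i | (r i <= t)%R && (y <= rem i t)%R]|)%N.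
    have := tiny t0 y0 (fun i => proj1 (andP (wK i))).
    rewrite -(leq_add2r #|[pred i | (r i <= t)%R && (y <= rem i t)%R]|).
    apply: leq_trans; rewrite -cardUI; apply: leq_trans (leq_addr _ _).
    apply: subset_leq_card; apply/fintype.subsetP => i /andP[rt W0].
    by rewrite !inE rt W0/=; case: ltP.
  rewrite -(ler_nat R) !natrD.
  have := large_count t0 y0 (fun i => proj2 (andP (wK i))); lra.
(* The idle machine [m] is free, so no alive job can be left unserved. *)
have : (alive_count t <= nserved job s t)%N.
  apply: subset_leq_card; apply/fintype.subsetP => i /andP[rt W0].
  apply/asboolP; apply: contrapT => ns.
  have nnp : ~ np_running np s t m by move=> [k [smk]]; move: nm; rewrite smk.
  have [_ /(_ i (conj rt W0) ns m nnp)[k [smk _]]] := srpt.2 t t0.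
  by move: nm; rewrite smk.
rewrite -(ler_nat R) => h; apply: (le_trans h).
rewrite -[leLHS]mul1r -[leLHS]addr0; apply: lerD; last by rewrite mulr_ge0.
by apply: ler_wpM2r; [exact: ler0n|lra].
Qed.

End Compare.

(** * Completion times and the workload lower bound on the cost *)

Section Completion.
Context {R : realType} {N : nat} {J T : finType}.
Variables (job : T -> J) (r : J -> R) (p : T -> R) (np : T -> bool).
Variable s : @schedule R N T.
Hypothesis r_ge0 : forall i, 0 <= r i.
Hypothesis p_gt0 : forall k, 0 < p k.
Hypothesis jobP : forall i, exists k, job k = i.
Hypothesis feas : feasible job r p np s.
Local Notation amount := (amount s).
Local Notation completion := (task_completion p s).
Local Notation jcompletion := (job_completion job p s).
Local Notation trem := (trem job p s).

Let done_lbound k : lbound [set t | task_done p s k t] (r (job k)).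
Proof.
move=> t /= dt; rewrite leNgt; apply/negP => /ltW tr.
by move: dt; rewrite /task_done (amount_before feas tr) leNgt p_gt0.
Qed.

Let done_has_inf k : has_inf [set t | task_done p s k t].
Proof.
split; last by exists (r (job k)); exact: done_lbound.
by case: feas => _ _ _ + _; apply.
Qed.

Lemma release_le_completion k : r (job k) <= completion k.
Proof. by apply: lb_le_inf; [case: (done_has_inf k)|exact: done_lbound]. Qed.

Lemma amount_lt_completion k t : t < completion k -> amount k t < p k.
Proof.
move=> tc; rewrite ltNge; apply/negP => dt; move: tc; rewrite ltNge => /negP; apply.
by apply: ge_inf => //; case: (done_has_inf k).
Qed.

(** The infimum defining the completion time is attained, because [amount] is Lipschitz. *)
Lemma completion_done k t : completion k <= t -> p k <= amount k t.
Proof.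
move=> ct; rewrite leNgt; apply/negP => tp.
have e0 : 0 < p k - amount k t by rewrite subr_gt0.
have [u du uc] := inf_adherent e0 (done_has_inf k).
have [ut|tu] := leP u t.
  have := le_amount r_ge0 feas k ut; move: du; rewrite /= /task_done; lra.
have := amount_lip r_ge0 feas k (ltW tu).
move: du uc; rewrite /= /task_done -/(completion k); lra.
Qed.

Lemma release_le_job_completion i : r i <= jcompletion i.
Proof.
have [k <-] := jobP i; apply: le_trans (release_le_completion k) _.
exact: le_bigmax_cond.
Qed.

(** The maximum defining [job_completion] starts from 0, whence the restriction to [0 <= t]. *)
Lemma lt_job_completion i t : 0 <= t -> t < jcompletion i ->
  exists2 k, job k = i & amount k t < p k.
Proof.
move=> t0; rewrite ltNge => /negP ct; apply: contrapT => nk; apply: ct.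
apply: bigmax_le => // k /eqP ki; rewrite leNgt; apply/negP => tc.
by apply: nk; exists k => //; exact: amount_lt_completion.
Qed.

Lemma trem_completed i t : jcompletion i <= t -> trem i t = 0.
Proof.
move=> ct; apply: big1 => k /eqP ki; apply/max_idPl.
rewrite subr_le0; apply: completion_done; apply: le_trans ct.
by apply: le_bigmax_cond; rewrite ki.
Qed.

(** Without parallelism a job needs service time at least its workload, all of it between release
    and completion. *)
Lemma work_le_flow i : work job p i <= jcompletion i - r i.
Proof.
have rC := release_le_job_completion i.
have := work_sub_trem feas i (jcompletion i).
rewrite (trem_completed (lexx _)) subr0 => /le_trans; apply.
apply: le_trans (le_len_co rC (measurable_srv feas i)).
apply: le_len.
- apply: measurable_coI; exact: (measurable_srv feas).
- apply: measurable_coI; exact: (measurable_srv feas).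
- apply: mu_coI_fin; exact: (measurable_srv feas).
- rewrite /co => u [su /= /andP[_ uC]]; split=> //=.
  by rewrite uC (srv_release feas su).
Qed.

Lemma sum_work_le_cost : \sum_i work job p i <= cost job r p s.
Proof. by apply: ler_sum => i _; exact: work_le_flow. Qed.

End Completion.

(** * Integration of the pointwise bound *)

Section Cost.
Context {R : realType} {N : nat} {J T : finType}.
Variables (job : T -> J) (r : J -> R) (p : T -> R) (np : T -> bool).
Variables s s' : @schedule R N T.
Hypothesis r_ge0 : forall i, 0 <= r i.
Hypothesis p_gt0 : forall k, 0 < p k.
Hypothesis jobP : forall i, exists k, job k = i.
Hypothesis srpt : msrpt job r p np s.
Hypothesis feas' : feasible job r p np s'.
Local Notation C := (job_completion job p s).
Local Notation C' := (job_completion job p s').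

Let feas : feasible job r p np s. Proof. by case: srpt. Qed.

Lemma cost_le (c : R) : 0 <= c ->
  (forall t, 0 <= t -> (alive_count job r p s t)%:R <=
    c * (nserved job s t)%:R + 2 * (alive_count' job r p s' t)%:R) ->
  cost job r p s <= (c + 2) * cost job r p s'.
Proof.
move=> c0 pointwise.
have rC := release_le_job_completion p_gt0 jobP feas.
have rC' := release_le_job_completion p_gt0 jobP feas'.
(* After the horizon [H] no job is pending under [s]; cutting there keeps the service sets of finite
   measure. *)
pose H := \big[Num.max/0]_i C i.
pose A i : set (measurableTypeR R) := co (r i) (C i).
pose B (j : J + J) : set (measurableTypeR R) := match j with
  | inl i => srv job s i `&` co 0 H | inr i => co (r i) (C' i) end.
pose d (j : J + J) : R := match j with inl _ => c | inr _ => 2 end.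
have AB : \sum_i len (A i) <= \sum_j d j * len (B j).
  apply: sum_len_le.
  - by move=> i; exact: measurable_co.
  - case=> i /=; last exact: measurable_co.
    apply: measurable_coI; exact: (measurable_srv feas).
  - by move=> i; rewrite mu_co// ltry.
  - case=> i /=; last by rewrite mu_co// ltry.
    apply: mu_coI_fin; exact: (measurable_srv feas).
  - by case.
  move=> u; rewrite big_sumType/=.
  have RHS0 : 0 <= \sum_i c * \1_(srv job s i `&` co 0 H) u +
      \sum_i 2 * \1_(co (r i) (C' i)) u.
    by apply: addr_ge0; apply: sumr_ge0 => i _; rewrite mulr_ge0.
  have [/andP[u0 uH]|] := boolP (0 <= u < H); last first.
    move=> nuH; rewrite big1// => i _; rewrite indicE memNset// /A/co/= => /andP[ru uC].
    move/negP: nuH; apply; rewrite (le_trans (r_ge0 i) ru) (lt_le_trans uC)//.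
    exact: le_bigmax.
  have LA : \sum_i \1_(A i) u <= (alive_count job r p s u)%:R :> R.
    rewrite /alive_count -sum1_card natr_sum [leRHS]big_mkcond; apply: ler_sum => i _.
    rewrite indicE inE; case: (boolP (u \in A i)) => uA; last by case: ifP.
    move: uA; rewrite inE /A/co/= => /andP[ru uC]; rewrite ru/=.
    have [k ki kp] := lt_job_completion p_gt0 feas u0 uC.
    (* One unfinished task makes the sum positive, as [amount_le] keeps the other terms
       nonnegative. *)
    rewrite ifT// /remaining (bigD1 k)/=; last exact/eqP.
    apply: ltr_wpDr; last by rewrite subr_gt0.
    by apply: sumr_ge0 => l _; rewrite subr_ge0; exact: (amount_le r_ge0 p_gt0 srpt).
  apply: (le_trans LA); apply: (le_trans (pointwise u u0)); apply: lerD.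
    rewrite -(sum_indic_srv job) mulr_sumr; apply: ler_sum => i _.
    by rewrite indicI /= [\1_(co 0 H) u]indicE mem_set ?mulr1// /co/= u0.
  rewrite -mulr_sumr ler_wpM2l// /alive_count' -sum1_card natr_sum [leLHS]big_mkcond.
  apply: ler_sum => i _; rewrite inE; case: ifPn => // /andP[ru tu].
  rewrite indicE mem_set// /co/= ru ltNge; apply/negP => Cu.
  by move: tu; rewrite (trem_completed r_ge0 p_gt0 feas' Cu) ltxx.
have costE : cost job r p s = \sum_i len (A i).
  by apply: eq_bigr => i _; rewrite len_co.
have costE' : cost job r p s' = \sum_i len (co (r i) (C' i) : set (measurableTypeR R)).
  by apply: eq_bigr => i _; rewrite len_co.
rewrite costE; apply: (le_trans AB); rewrite big_sumType/= -!mulr_sumr [leRHS]mulrDl.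
apply: lerD; last by rewrite costE'.
apply: ler_wpM2l => //.
apply: le_trans (sum_work_le_cost r_ge0 p_gt0 jobP feas').
(* The service time up to [H] is the workload minus [rem i H], which is nonnegative. *)
apply: ler_sum => i _; have := rem_ge0 r_ge0 p_gt0 srpt i H.
by rewrite (remainingE feas) subr_ge0.
Qed.

End Cost.

(** * Number of thresholds and the competitive ratio *)

Lemma exists_threshold (R : realType) (y z : R) : 0 < y -> y <= z ->
  exists2 K : nat, K%:R <= log2 (z / y) & z <= threshold y K.
Proof.
move=> y0 yz; have z0 := lt_le_trans y0 yz.
have ln2 : 0 < ln (2 : R) by rewrite ln_gt0 ?ltr1n.
have a1 : 1 <= z / y by rewrite ler_pdivlMr// mul1r.
have a0 : 0 < z / y by exact: divr_gt0.
have l0 : 0 <= log2 (z / y) by apply: divr_ge0; [exact: ln_ge0|exact: ltW].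
have /andP[Kl lK] := truncn_itv l0.
(* Rounding down suffices because [threshold y K] equals [y * 2 ^+ K.+1]. *)
exists (Num.truncn (log2 (z / y))) => //; set K := Num.truncn _ in lK *.
have : z / y < 2 ^+ K.+1.
  rewrite -ltr_ln ?posrE ?exprn_gt0// lnXn// -[ltRHS]mulr_natl.
  by move: lK; rewrite /log2 ltr_pdivrMr.
by rewrite ltr_pdivrMr// /threshold exprS => h; apply: ltW; rewrite mulrAC.
Qed.

Theorem theorem1 (R : realType) (N : nat) (J T : finType)
  (job : T -> J) (r : J -> R) (p : T -> R) (np : T -> bool) :
  (0 < N)%N ->
  (forall i, 0 <= r i) ->
  (forall k, 0 < p k) ->
  (forall i, exists k, job k = i) ->
  forall salg : @schedule R N T, msrpt job r p np salg ->
  forall s : @schedule R N T, feasible job r p np s ->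
  cost job r p salg <=
    (4 * log2 (alpha job p) + 2 * beta job p np + 8) * cost job r p s.
Proof.
move=> N0 r0 p0 jobP salg srpt s feas.
(* Without jobs both costs vanish; otherwise the minimal workload is positive. *)
have [J0|/existsNP[i0 _]] := pselect (forall i : J, False); last first.
  pose y := work_min job p.
  have work_gt0 i : 0 < work job p i.
    have [k ki] := jobP i; rewrite /work (bigD1 k)/=; last exact/eqP.
    by apply: ltr_wpDr => //; apply: sumr_ge0 => l _; exact: ltW.
  have wM i : work job p i <= work_max job p by exact: le_bigmax.
  have yw i : y <= work job p i by exact: bigmin_le_cond.
  have y0 : 0 < y.
    by apply: lt_bigmin => //; exact: lt_le_trans (work_gt0 i0) (wM i0).
  have [K Kl MK] := exists_threshold y0 (le_trans (yw i0) (wM i0)).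
  have ey : 0 <= beta job p np by rewrite divr_ge0 ?eta_ge0 ?ltW.
  have K0 : 0 <= K%:R :> R by exact: ler0n.
  have c0 : 0 <= 2 * K%:R + 6 + beta job p np by lra.
  have cost0 : 0 <= cost job r p s.
    by apply: le_trans (sum_work_le_cost r0 p0 jobP feas); apply: sumr_ge0 => i _; exact: ltW.
  apply: le_trans (cost_le r0 p0 jobP srpt feas c0 _) _.
    move=> t t0; apply: (alive_count_le N0 r0 p0 srpt feas t0 y0) => i.
    by rewrite yw (le_trans (wM i)).
  (* The factor obtained is [2 * K + 8 + beta], with [0 <= K <= log2 alpha] and [0 <= beta]. *)
  apply: ler_wpM2r => //; move: Kl; rewrite -/(alpha job p); lra.
rewrite /cost [leLHS]big1; last by move=> i; case: (J0 i).
by rewrite big1 ?mulr0// => i; case: (J0 i).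
Qed.
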